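(* Fix positive integers $d<k$. Then the quantity $m_{d}(k,n)/\binom{n-d}{k-d}$ converges to a limit $\mu_{d}(k)\in[0,1]$ as $n$ tends to infinity along the positive integers divisible by $k$.
   Context: A $k$-graph (k-uniform hypergraph) $H=(V,E)$ has $E$ a family of $k$-element subsets of the finite set $V$. For $S\subseteq V$ with $0\le|S|\le k-1$, $\deg_H(S)$ is the number of edges of $H$ containing $S$; the minimum $d$-degree $\delta_d(H)$ is the minimum of $\deg_H(S)$ over all $d$-subsets $S$ of $V$. A perfect matching is a set of pairwise disjoint edges covering all vertices. For integers $1\le d\le k-1$ and $n$ divisible by $k$, $m_d(k,n)$ is the smallest integer $m$ such that every $n$-vertex $k$-graph $H$ with $\delta_d(H)\ge m$ has a perfect matching. *)

(* Defs.v *)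
From mathcomp Require Import all_boot.

Set Implicit Arguments.
Unset Strict Implicit.
Unset Printing Implicit Defensive.

(* A hypergraph on the finite vertex set T is given by its edge set E. *)

Definition kgraph (T : finType) (k : nat) (E : {set {set T}}) : bool :=
  [forall e in E, #|e| == k].

Definition degree (T : finType) (E : {set {set T}}) (S : {set T}) : nat :=
  #|[set e in E | S \subset e]|.

(* Since degree E S <= #|E|, the initial value #|E| does not affect the
   minimum as soon as T has a subset of size d, i.e., when d <= #|T|. *)
Definition min_degree (T : finType) (d : nat) (E : {set {set T}}) : nat :=
  \big[minn/#|E|]_(S : {set T} | #|S| == d) degree E S.

Definition perfect_matching (T : finType) (E M : {set {set T}}) : bool :=
  [&& M \subset E, trivIset M & cover M == [set: T]].

Definition has_perfect_matching (T : finType) (E : {set {set T}}) : bool :=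
  [exists M : {set {set T}}, perfect_matching E M].

Definition forces_pm (d k n m : nat) : bool :=
  [forall E : {set {set 'I_n}},
    kgraph k E ==> (m <= min_degree d E) ==> has_perfect_matching E].

Lemma min_degree_le (T : finType) (d : nat) (E : {set {set T}}) :
  min_degree d E <= #|E|.
Proof.
rewrite /min_degree; elim/big_ind: _ => // [x y xE _|S _].
  exact: leq_trans (geq_minl x y) xE.
by apply/subset_leq_card/subsetP => e; rewrite inE => /andP[].
Qed.

Lemma forces_pm_ex (d k n : nat) : exists m, forces_pm d k n m.
Proof.
exists #|{: {set 'I_n}}|.+1; apply/forallP => E; apply/implyP => _.
apply/implyP => lt_card; have := leq_trans lt_card (min_degree_le d E).
by rewrite ltnNge max_card.
Qed.

(* Only m in nat matters in the minimum over the integers: as degrees are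
   nonnegative, a negative m forces a perfect matching iff 0 does, and for
   n > 0 neither does, because of the edgeless k-graph. *)
Definition pm_threshold (d k n : nat) : nat := ex_minn (forces_pm_ex d k n).

(* Main.v *)
(* Write [b n] for the threshold divided by [n^(k-d) / (k-d)!]. Suppose that a
   [k]-graph [H] on [n] vertices has minimum [d]-degree slightly above density
   [b r], where [r] is large and [n] is huge. By Chernoff's bound, for every
   vertex [v], all but a fraction exponentially small in [r] of the [r]-sets
   through [v] inherit the degree condition, and so induce a subgraph of [H]
   with a perfect matching. When [r] divides [n], a switching argument
   partitions the vertices into such [r]-sets: only a failure fraction below
   [1 / (2 r)] is required, so neither absorption nor a lower bound on the
   threshold enters. Otherwise one first removes fewer than [r / k] edges.
   Hence [b n <= b r + eps] for all large [r] and all [n] large in terms of [r],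
   which forces [b] to converge. *)
Require Import Defs.
From mathcomp Require Import all_boot all_algebra perm zify.
From mathcomp Require action primitive_action alt.

Set Implicit Arguments.
Unset Strict Implicit.
Unset Printing Implicit Defensive.

(** * Counting tuples with prescribed coordinates *)

Lemma leq_card_bigcup (I T : finType) (P : pred I) (F : I -> {set T}) :
  #|\bigcup_(i | P i) F i| <= \sum_(i | P i) #|F i|.
Proof.
elim/big_rec2: _ => [|i m A _ le_mA]; first by rewrite cards0.
by apply: leq_trans (leq_card_setU _ _) _; rewrite leq_add2l.
Qed.

(** The symmetric group on [T] is transitive on tuples of [#|T|] distinct points, hence also on
    shorter ones. *)
Lemma injection_perm (I T : finType) (f g : I -> T) :
  injective f -> injective g -> exists s : {perm T}, forall i, s (f i) = g i.
Proof.
move=> fI gI.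
pose tup (h : I -> T) := [tuple h (enum_val j) | j < #|I|].
have dtup h : injective h -> tup h \in primitive_action.dtuple_on #|I| [set: T].
  move=> hI; apply/primitive_action.dtuple_onP; split=> [i j|i]; last by rewrite inE.
  by rewrite !tnth_mktuple => /hI /enum_val_inj.
have IT : #|I| <= #|T| := leq_card f fI.
have tr := primitive_action.ntransitive_weak (G := alt.Sym_group T) IT (alt.Sym_trans T).
have := action.atransP2 tr (dtup f fI) (dtup g gI).
case=> s _ e; exists s => i.
have := congr1 (fun t => tnth t (enum_rank i)) e.
by rewrite !tnth_map !tnth_ord_tuple enum_rankK => ->.
Qed.

(** The values at points of the codomain of [f] are forced, and those at the remaining points are
    free. *)
Lemma card_ffun_fiber (A T V : finType) (f : A -> T) (y : {ffun A -> V}) :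
  injective f ->
  #|[set x : {ffun T -> V} | [forall a, x (f a) == y a]]| = #|V| ^ (#|T| - #|A|).
Proof.
move=> fI.
pose F t := [pred v : V | [forall a, (f a == t) ==> (v == y a)]].
have -> : #|[set x : {ffun T -> V} | [forall a, x (f a) == y a]]| = #|family F|.
  apply: eq_card => x; rewrite inE.
  apply/forallP/familyP => [H t | H a].
    by rewrite inE; apply/forallP => a; apply/implyP => /eqP <-.
  by have := H (f a); rewrite inE => /forallP/(_ a); rewrite eqxx.
rewrite card_family foldrE big_map big_enum /=.
rewrite (bigID (fun t => t \in codom f)) /= big1 => [|t /codomP [a ->]]; last first.
  rewrite (eq_card (B := pred1 (y a))) ?card1 // => v; rewrite !inE.
  apply/forallP/eqP => [/(_ a)|-> b]; first by rewrite eqxx => /eqP.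
  by apply/implyP => /eqP/fI ->.
rewrite mul1n (eq_bigr (fun=> #|V|)) => [|t Ht].
  rewrite prod_nat_const; congr (_ ^ _).
  by rewrite -(cardC (mem (codom f))) card_codom // addKn.
apply: eq_card => v; rewrite !inE; apply/forallP => a; apply/implyP => /eqP e.
by rewrite -e codom_f in Ht.
Qed.

Lemma card_ffun_fix (I V : finType) (i : I) (v : V) :
  #|[set x : {ffun I -> V} | x i == v]| = #|V| ^ #|I|.-1.
Proof.
have uI : injective (fun _ : unit => i) by move=> [] [].
rewrite -subn1 -card_unit -(card_ffun_fiber [ffun=> v] uI).
apply: eq_card => x; rewrite !inE.
by apply/idP/forallP => [H []|/(_ tt)]; rewrite ffunE.
Qed.

Lemma card_ffun_meets (I V : finType) (S : {set V}) :
  #|[set x : {ffun I -> V} | [exists i, x i \in S]]| <= #|I| * #|S| * #|V| ^ #|I|.-1.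
Proof.
apply: leq_trans (_ : \sum_(i : I) \sum_(v in S) #|V| ^ #|I|.-1 <= _); last first.
  by rewrite !sum_nat_const mulnA.
have sub : [set x : {ffun I -> V} | [exists i, x i \in S]] \subset
    \bigcup_(i : I) \bigcup_(v in S) [set x : {ffun I -> V} | x i == v].
  apply/subsetP => x; rewrite inE => /existsP [i xi].
  by apply/bigcupP; exists i => //; apply/bigcupP; exists (x i); rewrite ?inE.
apply: leq_trans (subset_leq_card sub) _.
apply: leq_trans (leq_card_bigcup _ _) _; apply: leq_sum => i _.
apply: leq_trans (leq_card_bigcup _ _) _; apply: leq_sum => v _.
by rewrite card_ffun_fix.
Qed.

(** * Matchings, degrees and thresholds *)

Lemma ffact_le_exp n m : n ^_ m <= n ^ m.
Proof.
by elim: m => // m IH; rewrite ffactnSr expnSr leq_mul // leq_subr.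
Qed.

(** Replacing the factors [n] by [n - d - i] one at a time costs at most [(d + i) * n ^ m.-1] each;
    the total is estimated crudely. *)
Lemma exp_le_ffact d n m : n ^ m <= (n - d) ^_ m + m * (m + d) * n ^ m.-1.
Proof.
elim: m => // m IH; rewrite ffactnSr /=.
have leX : (n - d) ^_ m <= n ^ m.
  by apply: leq_trans (ffact_le_exp _ _) _; case: m {IH} => // m; rewrite leq_exp2r ?leq_subr.
have := leq_mul IH (leqnn n); rewrite -expnSr.
have -> : ((n - d) ^_ m + m * (m + d) * n ^ m.-1) * n = (n - d) ^_ m * n + m * (m + d) * n ^ m.
  by case: m {IH leX} => [|m] /=; rewrite ?expnS; nia.
rewrite mulnBr mulnBr; move: leX; set X := n ^ m; set Y := _ ^_ m; nia.
Qed.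

Lemma bin_le_exp n m : 'C(n, m) <= n ^ m.
Proof.
apply: leq_trans (ffact_le_exp n m); rewrite -bin_ffact.
by rewrite leq_pmulr ?fact_gt0.
Qed.

Section Hypergraphs.

Implicit Types T V : finType.

(** For injective [f] this is a copy of the subgraph induced on the image of [f]. Thresholds refer
    to vertex sets ['I_n] only, so they are applied to induced subgraphs through such copies. *)
Definition pull T V (f : T -> V) (E : {set {set V}}) : {set {set T}} :=
  [set e : {set T} | f @: e \in E].

(** As the cover is exactly [Q], this is a perfect matching of the subgraph induced on [Q]. *)
Definition matchable T (E : {set {set T}}) (Q : {set T}) : bool :=
  [exists M : {set {set T}}, [&& M \subset E, trivIset M & cover M == Q]].

Lemma matchableP T (E : {set {set T}}) (Q : {set T}) :
  reflect (exists M : {set {set T}}, [/\ M \subset E, trivIset M & cover M = Q])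
    (matchable E Q).
Proof.
apply: (iffP existsP) => -[M].
  by case/and3P=> ? ? /eqP ?; exists M.
by case=> ? ? /eqP ?; exists M; apply/and3P.
Qed.

Lemma matchable_edge T (E : {set {set T}}) e : e \in E -> matchable E e.
Proof.
move=> eE; apply/matchableP; exists [set e].
by rewrite sub1set eE trivIset1 cover1.
Qed.

Lemma matchable0 T (E : {set {set T}}) : matchable E set0.
Proof.
apply/matchableP; exists set0; split; rewrite ?sub0set //.
  by apply/trivIsetP => A; rewrite inE.
by rewrite /cover big_set0.
Qed.

Lemma matchableU T (E : {set {set T}}) (A B : {set T}) :
  [disjoint A & B] -> matchable E A -> matchable E B -> matchable E (A :|: B).
Proof.
move=> dAB /matchableP [M [ME tM cM]] /matchableP [N [NE tN cN]].
apply/matchableP; exists (M :|: N); split; first by rewrite subUset ME.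
  by rewrite trivIsetU // cM cN.
by rewrite /cover bigcup_setU -/(cover M) -/(cover N) cM cN.
Qed.

Lemma matchable_bigcup T (E : {set {set T}}) (I : finType) (F : I -> {set T}) :
  (forall i j, i != j -> [disjoint F i & F j]) ->
  (forall i, matchable E (F i)) -> matchable E (\bigcup_i F i).
Proof.
move=> dF mF; rewrite -big_enum; have := enum_uniq I.
elim: (enum I) => [|i s IH] /=; first by rewrite big_nil matchable0.
case/andP=> is_ us; rewrite big_cons; apply: matchableU => //; last exact: IH.
rewrite -setI_eq0; apply/eqP/setP => x; rewrite in_setI in_set0 bigcup_seq.
apply/andP => -[xi /bigcupP [j js xj]].
have /dF dij : i != j by apply: contraNneq is_ => ->.
by rewrite (disjointFr dij xi) in xj.
Qed.

Lemma pull_kgraph T V (f : T -> V) k E :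
  injective f -> kgraph k E -> kgraph k (pull f E).
Proof.
move=> fI /forall_inP kE; apply/forall_inP => e; rewrite inE => /kE.
by rewrite card_imset.
Qed.

Lemma matchable_pull T V (f : T -> V) E (A : {set T}) :
  injective f -> matchable (pull f E) A -> matchable E (f @: A).
Proof.
move=> fI /matchableP [M [ME tM cM]]; apply/matchableP.
exists [set f @: e | e : {set T} in M]; split.
- by apply/subsetP => _ /imsetP [e eM ->]; have := subsetP ME e eM; rewrite inE.
- apply/trivIsetP => _ _ /imsetP [A1 A1M ->] /imsetP [A2 A2M ->] neq.
  rewrite imset_disjoint //.
  by apply: (trivIsetP tM) => //; apply: contraNneq neq => ->.
- by rewrite cover_imset -cM imset_cover.
Qed.

Lemma has_pm_matchable T (E : {set {set T}}) :
  has_perfect_matching E = matchable E setT.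
Proof. by []. Qed.

Lemma injection_onto V (Q : {set V}) n :
  #|Q| = n -> exists f : 'I_n -> V, injective f /\ f @: setT = Q.
Proof.
move=> <-; exists enum_val; split; first exact: enum_val_inj.
apply/setP => v; apply/imsetP/idP => [[i _ ->]|vQ]; first exact: enum_valP.
by exists (enum_rank_in vQ v); rewrite ?enum_rankK_in.
Qed.

Lemma min_degree_le_degree T d (E : {set {set T}}) (S : {set T}) :
  #|S| = d -> min_degree d E <= degree E S.
Proof.
move/eqP => cS; rewrite /min_degree.
have := mem_index_enum S; elim: (index_enum _) => //= A s IH.
rewrite in_cons big_cons; case: eqVneq => [<- _|_ /= /IH le]; first by rewrite cS geq_minl.
by case: ifP => // _; apply: leq_trans (geq_minr _ _) le.
Qed.

Lemma leq_min_degree T d (E : {set {set T}}) m :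
  d <= #|T| -> (forall S : {set T}, #|S| = d -> m <= degree E S) ->
  m <= min_degree d E.
Proof.
move=> dT mE; rewrite /min_degree; elim/big_ind: _ => [|x y mx my|S /eqP]; last exact: mE.
  (* The initial value [#|E|] of the minimum dominates the degree of some [d]-set, which exists by
     [d <= #|T|]. *)
  have : 0 < #|[set S : {set T} | #|S| == d]| by rewrite card_draws bin_gt0.
  case/card_gt0P=> S; rewrite inE => /eqP/mE mS; apply: leq_trans mS _.
  by apply/subset_leq_card/subsetP => e; rewrite inE => /andP [].
by rewrite leq_min mx.
Qed.

(** Removing [S] maps the edges through [S] injectively to subsets of the complement of [S] of size
    [k - #|S|]. *)
Lemma degree_le_bin T k (E : {set {set T}}) (S : {set T}) :
  kgraph k E -> degree E S <= 'C(#|T| - #|S|, k - #|S|).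
Proof.
move=> /forall_inP kE.
have -> : #|T| - #|S| = #|~: S| by rewrite -(cardsC S) addKn.
rewrite -cards_draws /degree.
rewrite -[X in X <= _](card_in_imset (f := fun e => e :\: S)); last first.
  move=> e1 e2; rewrite !inE => /andP [_ S1] /andP [_ S2] /= e12.
  by rewrite -(setID e1 S) -(setID e2 S) (setIidPr S1) (setIidPr S2) e12.
apply/subset_leq_card/subsetP => _ /imsetP [e /setIdP [eE Se] ->].
rewrite inE cardsDS // (eqP (kE e eE)) eqxx andbT.
by apply/subsetP => x; rewrite !inE => /andP [].
Qed.

(** An edge through [f @: S] either lies in the image of [f], and survives in the pullback, or
    contains one of the [#|V| - #|T|] vertices outside it. *)
Lemma degree_pull T V (f : T -> V) k (E : {set {set V}}) (S : {set T}) :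
  injective f -> kgraph k E ->
  degree E (f @: S) <= degree (pull f E) S
    + (#|V| - #|T|) * 'C(#|V| - #|S|.+1, k - #|S|.+1).
Proof.
move=> fI kE; pose Q := f @: [set: T].
have cQ : #|~: Q| = #|V| - #|T|.
  by rewrite -(cardsC Q) (card_imset _ fI) cardsT addKn.
have sub : [set e in E | f @: S \subset e] \subset
    [set f @: e | e : {set T} in [set e in pull f E | S \subset e]]
    :|: \bigcup_(v in ~: Q) [set e in E | v |: (f @: S) \subset e].
  apply/subsetP => e; rewrite inE => /andP [eE Se].
  have [eQ|/subsetPn [v ve vQ]] := boolP (e \subset Q); last first.
    apply/setUP; right; apply/bigcupP; exists v; first by rewrite inE.
    by rewrite inE eE subUset sub1set ve.
  have fe : f @: (f @^-1: e) = e.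
    apply/setP => v; apply/imsetP/idP => [[x]|ve]; first by rewrite inE => ? ->.
    by have /imsetP [x _ vx] := subsetP eQ v ve; exists x; rewrite ?inE -?vx.
  apply/setUP; left; apply/imsetP; exists (f @^-1: e) => //.
  by rewrite !inE fe eE -sub_imset_pre.
rewrite /degree; apply: leq_trans (subset_leq_card sub) _.
apply: leq_trans (leq_card_setU _ _) _.
rewrite leq_add ?leq_imset_card //.
apply: leq_trans (leq_card_bigcup _ _) _; rewrite -cQ -sum_nat_const.
apply: leq_sum => v; rewrite inE => vQ; rewrite -/(degree E (v |: (f @: S))).
apply: leq_trans (degree_le_bin _ kE) _.
rewrite cardsU1 (card_imset _ fI); suff -> : v \notin f @: S by [].
by apply: contra vQ => /imsetP [x _ ->]; apply: imset_f.
Qed.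

(** Ordered versions of the edges of the link of [D]: tuples are comparable with independently
    sampled vertices. *)
Definition link_tuples T e (E : {set {set T}}) (D : {set T}) : {set {ffun 'I_e -> T}} :=
  [set y : {ffun 'I_e -> T} | [&& injectiveb y,
     [disjoint D & y @: setT] & D :|: y @: setT \in E]].

Lemma card_link_tuples T k (E : {set {set T}}) (D : {set T}) :
  kgraph k E -> #|link_tuples (k - #|D|) E D| = (k - #|D|)`! * degree E D.
Proof.
move=> /forall_inP kE; set e := k - #|D|.
pose im (y : {ffun 'I_e -> T}) := D :|: y @: setT.
rewrite mulnC -sum_nat_const -sum1_card.
rewrite (partition_big im (mem [set A in E | D \subset A])) /=; last first.
  by move=> y; rewrite !inE => /and3P [_ _ ->]; rewrite subsetUl.
apply: eq_bigr => A; rewrite inE => /andP [AE DA].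
have cA : #|A :\: D| = e by rewrite cardsDS // (eqP (kE _ AE)).
have := card_inj_ffuns_on 'I_e (mem (A :\: D)); rewrite card_ord cA ffactnn => <-.
rewrite sum1_card; apply: eq_card => y; rewrite !inE unfold_in inE.
have [yI|] := boolP (injectiveb y); last by rewrite andbF.
have cy : #|y @: setT| = e by rewrite card_imset ?cardsT ?card_ord //; apply/injectiveP.
rewrite andbT /=; apply/idP/ffun_onP => [/andP [/andP [dy _] /eqP <-] i|yA].
  have yi : y i \in y @: setT by rewrite imset_f.
  by rewrite !inE yi orbT andbT; apply: contraTN yi => iD; rewrite (disjointFr dy).
have eqA : y @: setT = A :\: D.
  apply/eqP; rewrite eqEcard cA cy leqnn andbT.
  by apply/subsetP => _ /imsetP [i _ ->].
have imA : im y = A by rewrite /im eqA setDE setUIr setUCr setIT; apply/setUidPr.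
rewrite -/(im y) imA AE eqxx eqA !andbT.
by rewrite -setI_eq0 setIC setIDAC setDIl setDv setI0.
Qed.

End Hypergraphs.

(** * Upper bounds for the threshold *)

Lemma subset_of_card (T : finType) (A : {set T}) m :
  m <= #|A| -> exists B : {set T}, B \subset A /\ #|B| = m.
Proof.
rewrite -bin_gt0 -cards_draws => /card_gt0P [B]; rewrite inE => /andP [BA /eqP cB].
by exists B.
Qed.

Lemma matchable_complete (T : finType) k N (E : {set {set T}}) (Q : {set T}) :
  (forall A : {set T}, #|A| = k -> A \in E) -> #|Q| = N * k -> matchable E Q.
Proof.
move=> allE; elim: N Q => [|N IH] Q.
  by rewrite mul0n => /eqP; rewrite cards_eq0 => /eqP ->; apply: matchable0.
rewrite mulSn => cQ; have [|A [AQ cA]] := @subset_of_card _ Q k; first by rewrite cQ leq_addr.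
rewrite -(setID Q A) (setIidPr AQ); apply: matchableU.
- by rewrite -setI_eq0; apply/eqP/setP => x; rewrite !inE; case: (x \in A).
- by apply: matchable_edge; apply: allE.
- by apply: IH; rewrite cardsDS // cQ cA addKn.
Qed.

(** Such a [k]-graph is complete: adding a missing [k]-set [A] would push the degree of a [d]-subset
    of [A] above its maximum possible value. *)
Lemma forces_pm_bin d k n : d <= k -> 0 < n -> k %| n -> forces_pm d k n 'C(n - d, k - d).
Proof.
move=> dk n0 kn; apply/forallP => E; apply/implyP => kE; apply/implyP => mE.
have /dvdnP [N nN] := kn.
rewrite has_pm_matchable; apply: (@matchable_complete _ k N); last by rewrite cardsT card_ord.
move=> A cA; have [|S [SA cS]] := @subset_of_card _ A d; first by rewrite cA.
apply: contraLR (leq_trans mE (min_degree_le_degree _ cS)) => AE; rewrite -ltnNge.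
have kE' : kgraph k (A |: E).
  apply/forall_inP => e; rewrite !inE => /orP [/eqP ->|eE]; first by rewrite cA.
  exact: (forall_inP kE).
have := degree_le_bin S kE'; rewrite card_ord cS; apply: leq_trans.
rewrite /degree -add1n -(cards1 A) -cardsUI.
have -> : [set A] :&: [set e in E | S \subset e] = set0.
  by apply/setP => B; rewrite !inE; case: eqP => // ->; rewrite (negPf AE).
rewrite cards0 addn0; apply/subset_leq_card/subsetP => B; rewrite !inE.
by case/orP => [/eqP ->|/andP [-> ->]]; rewrite ?eqxx ?SA ?orbT.
Qed.

Lemma pm_threshold_min d k n m : forces_pm d k n m -> pm_threshold d k n <= m.
Proof. by rewrite /pm_threshold; case: ex_minnP => t _; apply. Qed.

Lemma pm_threshold_forces d k n (E : {set {set 'I_n}}) :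
  kgraph k E -> pm_threshold d k n <= min_degree d E -> matchable E setT.
Proof.
rewrite /pm_threshold; case: ex_minnP => t /forallP/(_ E) + _ kE tE.
by rewrite kE tE.
Qed.

(** Put one edge into the matching and delete its [k] vertices; each deleted vertex lowers a
    [d]-degree by at most [(n + k) ^ (k - d.+1)]. *)
Lemma pm_threshold_step d k n :
  d < k -> d <= n ->
  pm_threshold d k (n + k) <= pm_threshold d k n + k * (n + k) ^ (k - d.+1).
Proof.
move=> dk dn; apply: pm_threshold_min; apply/forallP => E.
apply/implyP => kE; apply/implyP => mE; rewrite has_pm_matchable.
have [|S0 [_ cS0]] := @subset_of_card _ [set: 'I_(n + k)] d.
  by rewrite cardsT card_ord; apply: leq_trans dn (leq_addr _ _).
(* The added term is positive, so an edge exists even if the threshold for [n] were zero. *)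
have : 0 < degree E S0.
  apply: leq_trans (leq_trans mE (min_degree_le_degree _ cS0)).
  have k0 : 0 < k by case: (k) dk.
  by rewrite addn_gt0 muln_gt0 expn_gt0 addn_gt0 k0 /= !orbT.
case/card_gt0P=> e0; rewrite inE => /andP [e0E _].
have ce0 : #|e0| = k := eqP (forall_inP kE _ e0E).
have [|f [fI fT]] := @injection_onto _ (~: e0) n.
  by have := cardsC e0; rewrite card_ord ce0; lia.
rewrite -(setUCr e0); apply: matchableU; first by rewrite -setI_eq0 setICr.
  exact: matchable_edge.
rewrite -fT; apply: matchable_pull => //.
apply: (pm_threshold_forces (d := d) (pull_kgraph fI kE)).
apply: leq_min_degree => [|S cS]; first by rewrite card_ord.
have := leq_trans mE (min_degree_le_degree _ (etrans (card_imset _ fI) cS)).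
move/leq_trans/(_ (degree_pull S fI kE)); rewrite !card_ord cS addKn.
have : 'C(n + k - d.+1, k - d.+1) <= (n + k) ^ (k - d.+1).
  apply: leq_trans (bin_le_exp _ _) _.
  by case: (k - d.+1) => // i; rewrite leq_exp2r ?leq_subr.
move=> leC H; rewrite -(leq_add2r (k * (n + k) ^ (k - d.+1))).
by apply: leq_trans H _; rewrite leq_add2l leq_mul2l leC orbT.
Qed.

Lemma pm_threshold_steps d k n j :
  d < k -> d <= n ->
  pm_threshold d k (n + j * k) <=
    pm_threshold d k n + j * k * (n + j * k) ^ (k - d.+1).
Proof.
move=> dk dn; elim: j => [|j IH]; first by rewrite mul0n addn0 leq_addr.
have -> : n + j.+1 * k = n + j * k + k by rewrite mulSn addnA addnAC.
apply: leq_trans (pm_threshold_step dk _) _; first by rewrite (leq_trans dn) ?leq_addr.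
rewrite mulSn mulnDl addnCA [leqLHS]addnC leq_add2l.
apply: leq_trans IH _; rewrite leq_add2l leq_mul2l; apply/orP; right.
by case: (k - d.+1) => // i; rewrite leq_exp2r ?leq_addr.
Qed.

Lemma pm_threshold_le_exp d k n :
  d <= k -> 0 < n -> k %| n -> pm_threshold d k n * (k - d)`! <= (n - d) ^_ (k - d).
Proof.
move=> dk n0 kn; rewrite -bin_ffact leq_mul2r.
by apply/orP; right; apply: pm_threshold_min; apply: forces_pm_bin.
Qed.

(** * Partitions into matchable sets *)

(** Overwriting the first component of [t l] by any element of [A] loses no information, since [t j]
    still records it, and it leaves [t i0] alone. *)
Lemma card_ffun_collision (I A B : finType) (i0 j l : I) (c : A * B) :
  j != l -> l != i0 ->
  #|A| * #|[set t : {ffun I -> A * B} | (t i0 == c) && ((t j).1 == (t l).1)]|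
  <= #|{: A * B}| ^ #|I|.-1.
Proof.
move=> jl li0; set K := [set t : {ffun I -> A * B} | _].
rewrite -(card_ffun_fix i0 c) -cardsT -cardsX.
pose upd (p : A * {ffun I -> A * B}) : {ffun I -> A * B} :=
  [ffun i => if i == l then (p.1, (p.2 l).2) else p.2 i].
rewrite -(card_in_imset (f := upd)); last first.
  move=> [a t] [b u]; rewrite !inE /= => /andP [_ /eqP tjl] /andP [_ /eqP ujl] /ffunP tu.
  have := tu l; rewrite !ffunE eqxx => -[ab tu2].
  have tuE i : i != l -> t i = u i by move=> il; have := tu i; rewrite !ffunE (negPf il).
  congr pair => //; apply/ffunP => i; have [->|/tuE //] := eqVneq i l.
  by rewrite [t l]surjective_pairing [u l]surjective_pairing -tjl -ujl tu2 (tuE j).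
apply/subset_leq_card/subsetP => _ /imsetP [[a t] + ->].
by rewrite !inE /= ffunE (eq_sym i0) (negPf li0) => /andP [].
Qed.

(* Take an injection whose number of good rows is maximal. If row [a0] is bad,
   join it with [r - 1] random other rows, shifted cyclically by random amounts,
   into an [r * r] array: each column is a random tuple through a vertex of
   row [a0], so by the union bound some choice makes all [r] columns good, and
   replacing the rows of the array by its columns increases the number of
   good rows. *)
Lemma partition_into_good (V : finType) (good : pred {set V}) r' N :
  let r := r'.+1 in
  #|V| = N * r -> 0 < N -> 2 * r ^ 2 <= N ->
  (forall v, 2 * r * #|[set x : {ffun 'I_r -> V} |
      [&& x ord0 == v, injectiveb x & ~~ good (x @: setT)]]| < #|V| ^ r') ->
  exists g : 'I_N * 'I_r -> V,
    injective g /\ forall a, good [set g (a, j) | j in [set: 'I_r]].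
Proof.
move=> r cV N0 rN badV.
pose C := ('I_N * 'I_r)%type.
have cC : #|{: C}| = #|V| by rewrite card_prod !card_ord cV.
pose row (g : {ffun C -> V}) a := [set g (a, j) | j in [set: 'I_r]].
pose goods g := [set a | good (row g a)].
have [h hI] : exists h : {ffun C -> V}, injectiveb h.
  have [f [fI _]] := @injection_onto V setT #|V| (cardsT V).
  exists [ffun c => f (cast_ord cC (enum_rank c))]; apply/injectiveP => c c'.
  by rewrite !ffunE => /fI /cast_ord_inj /enum_rank_inj.
have [g gI gmax] := arg_maxnP (P := fun g : {ffun C -> V} => injectiveb g)
  (fun g => #|goods g|) hI.
exists g; split; first exact/injectiveP.
move=> a0; apply/negPn/negP => bad0.
move/injectiveP: gI => gI.
pose X := [set t : {ffun 'I_r -> C} | t ord0 == (a0, ord0)].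
have cX : #|X| = #|V| ^ r' by rewrite card_ffun_fix cC card_ord.
pose col (t : {ffun 'I_r -> C}) (i : 'I_r) : {ffun 'I_r -> V} :=
  [ffun j => g ((t j).1, ((t j).2 + i)%R)].
pose rows (t : {ffun 'I_r -> C}) : {ffun 'I_r -> 'I_N} := [ffun j => (t j).1].
have colI t i : injectiveb (rows t) -> injectiveb (col t i).
  move/injectiveP=> tI; apply/injectiveP => j j'; rewrite !ffunE => /gI/pair_equal_spec [e _].
  by apply: tI; rewrite !ffunE.
have [t [t0 tI tgood]] : exists t, [/\ t \in X, injectiveb (rows t)
    & forall i, good (col t i @: setT)].
  pose B i := [set t in X | injectiveb (rows t) && ~~ good (col t i @: setT)].
  pose K j l := [set t : {ffun 'I_r -> C} | (t ord0 == (a0, ord0)) && ((t j).1 == (t l).1)].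
  (* Column [i] determines [t], as [g] is injective and the shift by [i] invertible, and it starts
     at [g (a0, i)]; so [badV] at this vertex applies. *)
  have cB i : 2 * r * #|B i| < #|X|.
    rewrite cX; apply: leq_ltn_trans (badV (g (a0, i))); rewrite leq_mul2l /=.
    rewrite -(card_imset (f := fun t => col t i)); last first.
      move=> t u /ffunP tu; apply/ffunP => j; have := tu j.
      rewrite !ffunE => /gI/pair_equal_spec [e1 e2].
      by rewrite [t j]surjective_pairing [u j]surjective_pairing e1 (GRing.addIr _ e2).
    apply/subset_leq_card/subsetP => _ /imsetP [t + ->].
    rewrite !inE => /andP [/eqP t0 /andP [tI tb]].
    by rewrite ffunE t0 /= GRing.add0r eqxx tb colI.
  have cK j l : j != l -> l != ord0 -> N * #|K j l| <= #|X|.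
    move=> jl l0; have := card_ffun_collision ((a0, ord0) : C) jl l0.
    by rewrite cX -cC !card_ord.
  (* Of two distinct positions one differs from [ord0]; it goes second, as [cK] requires. *)
  pose P (p : 'I_r * 'I_r) := (p.1 != p.2) && (p.2 != ord0).
  (* The [r] columns fail on less than half of [X], each on a fraction below [1 / (2 r)]. At most
     [r ^ 2] collisions, each of fraction at most [1 / N], cover at most half, by
     [2 * r ^ 2 <= N]. *)
  have cU : #|\bigcup_i B i :|: \bigcup_(p | P p) K p.1 p.2| < #|X|.
    apply: leq_ltn_trans (leq_card_setU _ _) _.
    have leB : 2 * #|\bigcup_i B i| < #|X|.
      rewrite -(ltn_pmul2l (ltn0Sn r')) -/r mulnA (mulnC r).
      apply: leq_ltn_trans (_ : \sum_(i < r) (2 * r * #|B i|) < _).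
        by rewrite -big_distrr /= leq_mul2l leq_card_bigcup orbT.
      have -> : r * #|X| = \sum_(i < r) #|X| by rewrite sum_nat_const card_ord.
      by rewrite /r !big_ord_recl -addSn leq_add // ?cB // leq_sum // => i _; apply: ltnW.
    have leK : 2 * #|\bigcup_(p | P p) K p.1 p.2| <= #|X|.
      rewrite -(leq_pmul2l N0) mulnCA.
      apply: leq_trans (_ : 2 * (r ^ 2 * #|X|) <= _); last first.
        by rewrite mulnA leq_mul2r rN orbT.
      rewrite leq_mul2l /=; apply: leq_trans (leq_mul (leqnn N) (leq_card_bigcup _ _)) _.
      rewrite big_distrr /=; apply: leq_trans (_ : \sum_(p | P p) #|X| <= _).
        by apply: leq_sum => p /andP [pne p0]; apply: cK.
      rewrite sum_nat_const leq_mul2r; apply/orP; right.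
      by apply: leq_trans (max_card _) _; rewrite card_prod !card_ord.
    by move: leB leK; lia.
  have : ~~ (X \subset \bigcup_i B i :|: \bigcup_(p | P p) K p.1 p.2).
    by apply: contraL cU => /subset_leq_card; rewrite -leqNgt.
  case/subsetPn=> t tX; rewrite inE negb_or => /andP [tB tK].
  have tI : injectiveb (rows t).
    apply/injectiveP => j l; rewrite !ffunE => ejl; apply/eqP; apply: contraNT tK => jl.
    have [l0|l0] := eqVneq l ord0; apply/bigcupP; [exists (l, j)|exists (j, l)] => //.
    - by rewrite /P /= eq_sym jl -l0.
    - by move: tX; rewrite !inE => ->; rewrite ejl eqxx.
    - by rewrite /P /= jl.
    - by move: tX; rewrite !inE => ->; rewrite ejl eqxx.
  exists t; split=> // i; apply: contraNT tB => bi.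
  by apply/bigcupP; exists i; rewrite // inE tX tI.
move/injectiveP: tI => tI.
pose g' : {ffun C -> V} := [ffun c =>
  if [pick i | rows t i == c.1] is Some i then col t i c.2 else g c].
have rowt i : row g' (rows t i) = col t i @: setT.
  apply: eq_imset => j; rewrite ffunE /=; case: pickP => [i' /eqP/tI -> //|/(_ i)].
  by rewrite eqxx.
have rowN b : (forall i, rows t i != b) -> row g' b = row g b.
  move=> bN; apply: eq_imset => j; rewrite ffunE /=; case: pickP => // i /=.
  by rewrite (negPf (bN i)).
have g'I : injectiveb g'.
  apply/injectiveP => -[b j] [b' j']; rewrite !ffunE /=.
  case: pickP => [i /eqP <-|bN]; case: pickP => [i' /eqP <-|b'N].
  - rewrite !ffunE => /gI/pair_equal_spec [e1 e2].
    have jj : j = j' by apply: tI; rewrite !ffunE.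
    by rewrite jj in e2 *; rewrite (GRing.addrI _ e2).
  - by rewrite !ffunE => /gI/pair_equal_spec [e1 _]; have := b'N j; rewrite !ffunE e1 eqxx.
  - by rewrite !ffunE => /gI/pair_equal_spec [e1 _]; have := bN j'; rewrite !ffunE -e1 eqxx.
  - by move/gI.
have := gmax _ g'I; apply/negP; rewrite -ltnNge; apply: proper_card.
rewrite properE; apply/andP; split.
  apply/subsetP => b; rewrite !inE => gb.
  have [/existsP [i /eqP <-]|] := boolP [exists i, rows t i == b]; first by rewrite rowt.
  by rewrite negb_exists => /forallP/rowN ->.
apply/subsetPn; exists a0; last by rewrite inE.
have : t ord0 == (a0, ord0) by rewrite inE in t0.
move/eqP=> te; have -> : a0 = rows t ord0 by rewrite ffunE te.
by rewrite inE rowt.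
Qed.

(* Exchanging the coordinates in [S] of two tuples is an involution on pairs,
   so the values of a tuple on [S] can be treated as independent of a resampled
   copy of the tuple. *)
Lemma card_resample (I V : finType) (S J : {set I}) i0 v d w
    (B : {set {ffun I -> V}}) (W : {set V} -> {set {ffun I -> V}}) :
  i0 \in S -> J \subset S ->
  (forall x, x \in B -> x i0 = v /\ #|x @: J| = d) ->
  (forall x (z : {ffun I -> V}), x \in B ->
    [ffun i => if i \in S then z i else x i] \in W (x @: J)) ->
  (forall D : {set V}, #|D| = d -> #|W D| <= w) ->
  #|B| * #|V| ^ #|I| <= #|V| ^ #|I|.-1 * w.
Proof.
move=> i0S JS B0 BW Ww.
pose ov (x z : {ffun I -> V}) := [ffun i => if i \in S then z i else x i].
pose F (p : {ffun I -> V} * {ffun I -> V}) := (ov p.1 p.2, ov p.2 p.1).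
have FK : involutive F.
  move=> [x z]; rewrite /F /=; congr pair; apply/ffunP => i; rewrite !ffunE;
  by case: (i \in S).
pose P (y : {ffun I -> V}) := (y i0 == v) && (#|y @: J| == d).
have -> : #|B| * #|V| ^ #|I| = #|setX B [set: {ffun I -> V}]|.
  by rewrite cardsX cardsT card_ffun.
rewrite -(card_imset _ (inv_inj FK)).
(* The exchanged tuple [y = ov z x] agrees with [x] on [S], so it determines [x @: J]; its partner
   [ov x z] then lies in [W (y @: J)]. *)
have sub : F @: setX B setT \subset
    \bigcup_(y | P y) [set (x, y) | x in W (y @: J)].
  apply/subsetP => _ /imsetP [[x z] + ->]; rewrite inE inE andbT => xB.
  have [x0 xJ] := B0 x xB.
  have eJ : ov z x @: J = x @: J.
    by apply: eq_in_imset => i iJ; rewrite ffunE (subsetP JS).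
  apply/bigcupP; exists (ov z x).
    by rewrite /P eJ xJ eqxx ffunE i0S x0 eqxx.
  by apply/imsetP; exists (ov x z); rewrite // eJ BW.
apply: leq_trans (subset_leq_card sub) _.
apply: leq_trans (leq_card_bigcup _ _) _.
rewrite -(card_ffun_fix i0 v) -sum_nat_const.
apply: leq_trans (_ : \sum_(y | P y) w <= _).
  apply: leq_sum => y /andP [_ /eqP yJ]; apply: leq_trans (leq_imset_card _ _) _.
  exact: Ww.
rewrite !sum_nat_const leq_mul2r; apply/orP; right.
by apply/subset_leq_card/subsetP => y; rewrite inE => /andP [].
Qed.

(** Positions are counted instead of values, so the count makes sense for tuples with repetitions
    and is symmetric in the coordinates. *)
Definition link_count (I T : finType) e (E : {set {set T}}) (D : {set T})
    (x : {ffun I -> T}) : nat :=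
  #|[set f : {ffun 'I_e -> I} | injectiveb f && ([ffun j => x (f j)] \in link_tuples e E D)]|.

Lemma link_count_pull (I T : finType) k (E : {set {set T}}) (J : {set I}) (x : {ffun I -> T}) :
  kgraph k E -> injective x ->
  link_count (k - #|J|) E (x @: J) x = (k - #|J|)`! * degree (pull x E) J.
Proof.
move=> kE xI; rewrite -(card_link_tuples J (pull_kgraph xI kE)).
apply: eq_card => f; rewrite !inE.
have -> : [ffun j => x (f j)] @: setT = x @: (f @: setT).
  by rewrite -imset_comp; apply: eq_imset => j; rewrite ffunE.
rewrite imset_disjoint // imsetU; case: (boolP (injectiveb f)) => //= /injectiveP fI.
have -> // : injectiveb [ffun j => x (f j)].
by apply/injectiveP => i j; rewrite !ffunE => /xI/fI.
Qed.

(** Only the injections that meet [S] notice the resampling. *)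
Lemma link_count_resample (I T : finType) e (E : {set {set T}}) (D : {set T})
    (S : {set I}) (x z : {ffun I -> T}) :
  link_count e E D [ffun i => if i \in S then z i else x i]
  <= link_count e E D x + e * #|S| * #|I| ^ e.-1.
Proof.
have := card_ffun_meets 'I_e S; rewrite card_ord -(leq_add2l (link_count e E D x)).
move=> le_meets; apply: leq_trans le_meets; apply: leq_trans (leq_card_setU _ _).
apply/subset_leq_card/subsetP => f; rewrite !inE => /andP [fI].
have [|/existsPn fS] := boolP [exists i, f i \in S]; first by rewrite orbT.
rewrite orbF fI /=.
have -> // : [ffun j => [ffun i => if i \in S then z i else x i] (f j)] = [ffun j => x (f j)].
by apply/ffunP => j; rewrite !ffunE (negPf (fS j)).
Qed.

(* The term [e * d.+1 * r'.+1 ^ e.-1] bounds the number of injections that meet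
   the at most [d + 1] resampled coordinates [ord0 |: J]. *)
Lemma card_low_degree (V : finType) d k r' m w v (E : {set {set V}}) (J : {set 'I_r'.+1}) :
  let e := k - d in
  #|J| = d -> kgraph k E ->
  (forall D : {set V}, #|D| = d ->
    #|[set x : {ffun 'I_r'.+1 -> V} |
        link_count e E D x <= e`! * m + e * d.+1 * r'.+1 ^ e.-1]| <= w) ->
  #|[set x : {ffun 'I_r'.+1 -> V} |
      [&& x ord0 == v, injectiveb x & degree (pull x E) J < m]]| * #|V| ^ r'.+1
  <= #|V| ^ r' * w.
Proof.
move=> e cJ kE Ww; set B := [set x | _].
have := @card_resample _ V (ord0 |: J) J ord0 v d w B
  (fun D => [set x : {ffun 'I_r'.+1 -> V} |
        link_count e E D x <= e`! * m + e * d.+1 * r'.+1 ^ e.-1]).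
rewrite card_ord; apply => //; first by rewrite !inE eqxx.
- exact: subsetUr.
- by move=> x; rewrite inE => /and3P [/eqP -> /injectiveP xI _]; rewrite card_imset.
move=> x z; rewrite !inE => /and3P [_ /injectiveP xI lt].
apply: leq_trans (link_count_resample _ _ _ _ _ _) _.
have := link_count_pull J kE xI; rewrite cJ -/e => ->.
rewrite card_ord leq_add ?leq_mul2l ?(ltnW lt) ?orbT //.
rewrite leq_mul2r leq_mul2l cardsU1 cJ; apply/orP; right; apply/orP; right.
by case: (_ \notin _); lia.
Qed.

(** If no [d]-set of positions has low degree, the sampled subgraph reaches the threshold for
    [r'.+1]; the binomial factor is the union bound over these sets. *)
Lemma card_unmatchable (V : finType) d k r' w v (E : {set {set V}}) :
  let e := k - d in
  d <= r'.+1 -> kgraph k E ->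
  (forall D : {set V}, #|D| = d ->
    #|[set x : {ffun 'I_r'.+1 -> V} |
        link_count e E D x <= e`! * pm_threshold d k r'.+1 + e * d.+1 * r'.+1 ^ e.-1]| <= w) ->
  #|[set x : {ffun 'I_r'.+1 -> V} |
      [&& x ord0 == v, injectiveb x & ~~ matchable E (x @: setT)]]| * #|V| ^ r'.+1
  <= 'C(r'.+1, d) * (#|V| ^ r' * w).
Proof.
move=> e dr kE Ww.
pose B (J : {set 'I_r'.+1}) := [set x : {ffun 'I_r'.+1 -> V} |
  [&& x ord0 == v, injectiveb x & degree (pull x E) J < pm_threshold d k r'.+1]].
apply: (@leq_trans (#|\bigcup_(J : {set 'I_r'.+1} | #|J| == d) B J| * #|V| ^ r'.+1)).
  rewrite leq_mul2r; apply/orP; right; apply/subset_leq_card/subsetP => x.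
  rewrite !inE => /and3P [x0 xI xM].
  have [/existsP [J /andP [cJ lJ]]|/existsPn noJ] :=
    boolP [exists J : {set 'I_r'.+1},
      (#|J| == d) && (degree (pull x E) J < pm_threshold d k r'.+1)].
    by apply/bigcupP; exists J; rewrite // inE x0 xI.
  case/negP: xM; apply: matchable_pull; first exact/injectiveP.
  apply: (pm_threshold_forces (d := d) (pull_kgraph (injectiveP _ xI) kE)).
  apply: leq_min_degree => [|J cJ]; first by rewrite card_ord.
  by have := noJ J; rewrite cJ eqxx /= -leqNgt.
apply: leq_trans (leq_mul (leq_card_bigcup _ _) (leqnn _)) _.
have <- : #|[set J : {set 'I_r'.+1} | #|J| == d]| = 'C(r'.+1, d).
  by rewrite card_draws card_ord.
rewrite big_distrl /= -sum_nat_const.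
rewrite [leqRHS](eq_bigl (fun J : {set 'I_r'.+1} => #|J| == d)); last by move=> J; rewrite inE.
by apply: leq_sum => J /eqP cJ; exact: (card_low_degree v cJ kE Ww).
Qed.

(** The factor [2 * r * 'C(r, d)] combines the failure fraction [1 / (2 r)] tolerated by the
    partition with the union bound over the [d]-sets of positions. *)
Lemma perfect_matching_of_concentration (V : finType) d k r' N w (E : {set {set V}}) :
  let e := k - d in let r := r'.+1 in
  d <= r -> kgraph k E -> #|V| = N * r -> 0 < N -> 2 * r ^ 2 <= N ->
  (forall D : {set V}, #|D| = d ->
    #|[set x : {ffun 'I_r -> V} |
        link_count e E D x <= e`! * pm_threshold d k r + e * d.+1 * r ^ e.-1]| <= w) ->
  2 * r * 'C(r, d) * w < #|V| ^ r ->
  matchable E setT.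
Proof.
move=> e r dr kE cV N0 rN Ww wV.
have V0 i : 0 < #|V| ^ i by rewrite expn_gt0 cV muln_gt0 N0.
have [v|g [gI gM]] := partition_into_good (good := matchable E) cV N0 rN.
  have := card_unmatchable v dr kE Ww; set b := #|_| => bw.
  rewrite -(ltn_pmul2r (V0 r)) -mulnA.
  apply: leq_ltn_trans (leq_mul (leqnn (2 * r)) bw) _.
  by rewrite (mulnCA 'C(_, _)) (mulnCA (2 * r)) ltn_pmul2l // mulnA.
have <- : \bigcup_a [set g (a, j) | j in [set: 'I_r]] = setT.
  have gT : g @: setT = setT.
    by apply/eqP; rewrite eqEcard subsetT card_imset // !cardsT card_prod !card_ord cV leqnn.
  apply/eqP; rewrite eqEsubset subsetT; apply/subsetP => v _.
  have : v \in g @: setT by rewrite gT.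
  by case/imsetP => -[a j] _ ->; apply/bigcupP; exists a; rewrite ?imset_f.
apply: matchable_bigcup => // a b ab; rewrite -setI_eq0; apply/eqP/setP => v.
rewrite !inE; apply/andP => -[/imsetP [i _ ->] /imsetP [j _ /gI /pair_equal_spec [e1 _]]].
by rewrite e1 eqxx in ab.
Qed.

(** * Concentration *)

From mathcomp Require Import all_boot all_order all_algebra.
From mathcomp Require Import all_classical all_reals all_analysis.
From mathcomp Require Import zify ring lra.
Import Order.TTheory GRing.Theory Num.Theory.
Import numFieldNormedType.Exports.

Local Open Scope ring_scope.

(** [expR z <= 1 / (1 - z)], and [(1 - z) * (1 + z + 2 * z ^+ 2) = 1 + z ^+ 2 * (1 - 2 * z)]. *)
Lemma expR_le_quadratic (R : realType) (z : R) : z <= 1 / 2 -> expR z <= 1 + z + 2 * z ^+ 2.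
Proof.
move=> z2; have z0 : 0 < 1 - z by lra.
have -> : expR z = (expR (- z))^-1 by rewrite expRN invrK.
apply: (@le_trans _ _ (1 - z)^-1).
  by rewrite lef_pV2 ?posrE ?expR_gt0 // expR_ge1Dx.
by rewrite -[leLHS]mul1r ler_pdivrMr //; nra.
Qed.

(** The restriction of a uniform tuple to the coordinates in the image of [f] is uniform. *)
Lemma sum_ffun_fibers (R : realType) (A T V : finType) (f : A -> T) (G : {ffun A -> V} -> R) :
  injective f ->
  \sum_(x : {ffun T -> V}) G [ffun a => x (f a)]
  = (#|V| ^ (#|T| - #|A|))%:R * \sum_(y : {ffun A -> V}) G y.
Proof.
move=> fI; rewrite (partition_big (fun x : {ffun T -> V} => [ffun a => x (f a)]) predT) //.
rewrite mulr_sumr; apply: eq_bigr => y _.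
rewrite (eq_bigr (fun=> G y)); last by move=> x /eqP ->.
rewrite sumr_const -(card_ffun_fiber y fI) mulr_natl; congr (_ *+ _).
have xyE (x : {ffun T -> V}) : ([ffun a => x (f a)] == y) = [forall a, x (f a) == y a].
  apply/eqP/forallP => [<- a|xy]; first by rewrite ffunE.
  by apply/ffunP => a; rewrite ffunE; apply/eqP.
by apply: eq_card => x; rewrite [RHS]inE -xyE.
Qed.

(** Independence: disjoint blocks of coordinates of a uniform tuple turn the mean of a product into
    a product of means. *)
Lemma sum_prod_blocks (R : realType) (T V : finType) m e (f : 'I_m * 'I_e -> T)
    (g : {ffun 'I_e -> V} -> R) :
  injective f ->
  \sum_(x : {ffun T -> V}) \prod_(b < m) g [ffun j => x (f (b, j))]
  = (#|V| ^ (#|T| - m * e))%:R * (\sum_y g y) ^+ m.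
Proof.
move=> fI.
pose G (y : {ffun 'I_m * 'I_e -> V}) := \prod_(b < m) g [ffun j => y (b, j)].
have -> : (m * e)%N = #|{: 'I_m * 'I_e}| by rewrite card_prod !card_ord.
transitivity (\sum_(x : {ffun T -> V}) G [ffun a => x (f a)]).
  apply: eq_bigr => x _; apply: eq_bigr => b _; congr (g _).
  by apply/ffunP => j; rewrite !ffunE.
rewrite sum_ffun_fibers //; congr (_ * _).
have -> : (\sum_y g y) ^+ m = \prod_(b < m) \sum_y g y.
  by rewrite prodr_const card_ord.
rewrite bigA_distr_bigA /=.
pose curry (y : {ffun 'I_m * 'I_e -> V}) : {ffun 'I_m -> {ffun 'I_e -> V}} :=
  [ffun b => [ffun j => y (b, j)]].
pose uncurry (h : {ffun 'I_m -> {ffun 'I_e -> V}}) : {ffun 'I_m * 'I_e -> V} :=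
  [ffun p => h p.1 p.2].
rewrite (reindex curry); last first.
  apply: onW_bij; exists uncurry => [y|h]; first by apply/ffunP => -[b j]; rewrite !ffunE.
  by apply/ffunP => b; apply/ffunP => j; rewrite !ffunE.
by apply: eq_bigr => y _; apply: eq_bigr => b _; rewrite ffunE.
Qed.

(* By symmetry all injections hit [F] equally often on average over [W], so the
   [m] disjoint blocks hit [F] at most [m * a] times on average over [W]; but
   for a uniform random tuple the blocks are independent and Chernoff's bound
   applies. *)
Lemma symmetric_set_small (R : realType) (T V : finType) m e (f : 'I_m * 'I_e -> T)
    (F : {set {ffun 'I_e -> V}}) (W : {set {ffun T -> V}}) (p a : R) :
  (0 < #|V|)%N -> injective f -> 0 <= a -> a < p ->
  p * (#|V| ^ e)%:R <= #|F|%:R ->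
  (forall (s : {perm T}) x, x \in W -> [ffun i => x (s i)] \in W) ->
  (forall x, x \in W ->
    #|[set h : {ffun 'I_e -> T} | injectiveb h && ([ffun j => x (h j)] \in F)]|%:R
      <= a * (#|T| ^_ e)%:R) ->
  #|W|%:R <= (#|V| ^ #|T|)%:R * expR (- (m%:R * (p - a) ^+ 2 / 8)).
Proof.
move=> V0 fI a0 ap Fp Wsym Wa.
have mT : (m * e <= #|T|)%N.
  by have := leq_card f fI; rewrite card_prod !card_ord.
have Ve : 0 < (#|V| ^ e)%:R :> R by rewrite ltr0n expn_gt0 V0.
have p1 : p <= 1.
  rewrite -(ler_pM2r Ve) mul1r; apply: le_trans Fp _; rewrite ler_nat.
  by apply: leq_trans (max_card _) _; rewrite card_ffun card_ord.
(* This [t] minimises the exponent [2 * t ^+ 2 - t * (p - a)] per block, with value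
   [- (p - a) ^+ 2 / 8]. *)
pose t := (p - a) / 4.
pose ind (y : {ffun 'I_e -> V}) : R := (y \in F)%:R.
pose z y := t * (p - ind y).
pose Z (x : {ffun T -> V}) := \sum_(b < m) z [ffun j => x (f (b, j))].
pose c := m%:R * (t * (p - a)).
have t0 : 0 < t by rewrite /t; lra.
have indP y : -1 <= p - ind y <= 1.
  by rewrite /ind; case: (y \in F); rewrite /= ?subr0; lra.
(* The blocks are independent and [p - ind] has mean at most 0, so only the constant and quadratic
   terms of the exponential count. *)
have upper : \sum_(x : {ffun T -> V}) expR (Z x)
    <= (#|V| ^ #|T|)%:R * expR (m%:R * (2 * t ^+ 2)).
  under eq_bigr do rewrite /Z expR_sum.
  rewrite (sum_prod_blocks (fun y => expR (z y)) fI) expRM_natl.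
  have -> : (#|V| ^ #|T|)%:R = (#|V| ^ (#|T| - m * e))%:R * (#|V| ^ e)%:R ^+ m :> R.
    by rewrite -natrX -expnM -natrM -expnD (mulnC e) subnK.
  rewrite -mulrA ler_wpM2l // -exprMn lerXn2r ?nnegrE.
  - by [].
  - by apply: sumr_ge0 => y _; apply: expR_ge0.
  - by rewrite mulr_ge0 // expR_ge0.
  apply: (@le_trans _ _ (\sum_(y : {ffun 'I_e -> V}) (1 + 2 * t ^+ 2 + t * (p - ind y)))).
    apply: ler_sum => y _; apply: le_trans (expR_le_quadratic _) _.
      have /andP [_ le1] := indP y.
      by have := ler_wpM2l (ltW t0) le1; rewrite -/(z y) /t; lra.
    rewrite /z; suff : (t * (p - ind y)) ^+ 2 <= t ^+ 2 by lra.
    by rewrite exprMn ler_piMr ?sqr_ge0 // -real_normK ?num_real // expr_le1 // ler_norml.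
  rewrite big_split /= -big_distrr /= sumrB !sumr_const.
  have -> : \sum_y ind y = #|F|%:R.
    by rewrite -sumr_const [RHS]big_mkcond /=; apply: eq_bigr => y _; rewrite /ind; case: ifP.
  rewrite card_ffun card_ord -[(1 + _) *+ _]mulr_natl -[p *+ _]mulr_natl.
  have := expR_ge1Dx (2 * t ^+ 2).
  set X := expR _ => leX; apply: (@le_trans _ _ ((#|V| ^ e)%:R * (1 + 2 * t ^+ 2))).
    by rewrite -lerBrDl subrr; nra.
  by rewrite ler_wpM2l // ltW.
(* The tangent of the exponential at [c] lies below it, so it suffices that [Z] averages at least
   [c] over [W]. *)
have lower : #|W|%:R * expR c <= \sum_(x : {ffun T -> V}) expR (Z x).
  have avg (h : {ffun 'I_e -> T}) : injective h ->
      #|[set x in W | [ffun j => x (h j)] \in F]|%:R <= a * #|W|%:R :> R.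
    move=> hI; pose cnt (h' : {ffun 'I_e -> T}) :=
      #|[set x in W | [ffun j => x (h' j)] \in F]|.
    have T0 : (0 < #|T| ^_ e)%N.
      by rewrite ffact_gt0; have := leq_card h hI; rewrite card_ord.
    (* A permutation carrying [h'] to [h] acts on [W] and sends the tuples hitting [F] along [h] to
       tuples hitting it along [h']. *)
    have cntE (h' : {ffun 'I_e -> T}) : injective h' -> (cnt h <= cnt h')%N.
      move=> h'I; have [s sE] := injection_perm h'I hI.
      rewrite /cnt.
      rewrite -(card_imset (f := fun x : {ffun T -> V} => [ffun i => x (s i)])); last first.
        move=> x y /ffunP xy; apply/ffunP => i.
        by have := xy (s^-1 i)%g; rewrite !ffunE permKV.
      apply/subset_leq_card/fintype.subsetP => _ /imsetP [x + ->].
      rewrite !inE => /andP [xW xF]; rewrite Wsym //=.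
      suff -> : [ffun j => [ffun i => x (s i)] (h' j)] = [ffun j => x (h j)] by [].
      by apply/ffunP => j; rewrite !ffunE sE.
    have dbl : (\sum_(h' : {ffun 'I_e -> T} | injectiveb h') cnt h'
        = \sum_(x in W) #|[set h' : {ffun 'I_e -> T} |
             injectiveb h' && ([ffun j => x (h' j)] \in F)]|)%N.
      rewrite /cnt.
      under eq_bigr do rewrite -sum1dep_card big_mkcondr /=.
      rewrite exchange_big /=; apply: eq_bigr => x _.
      by rewrite -big_mkcondr sum1dep_card.
    have : (#|T| ^_ e * cnt h)%:R <= #|W|%:R * (a * (#|T| ^_ e)%:R).
      apply: (@le_trans _ _ (\sum_(h' : {ffun 'I_e -> T} | injectiveb h') cnt h')%:R).
        have := card_inj_ffuns 'I_e T; rewrite card_ord => <-; rewrite -sum_nat_const ler_nat.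
        rewrite (eq_bigl (fun h' : {ffun 'I_e -> T} => injectiveb h')); last first.
          by move=> h'; rewrite inE.
        by apply: leq_sum => h' /injectiveP; apply: cntE.
      rewrite dbl natr_sum mulr_natl -sumr_const; apply: ler_sum => x xW.
      exact: Wa.
    by rewrite natrM mulrA [leRHS]mulrC ler_pM2l ?ltr0n // mulrC.
  apply: (@le_trans _ _ (\sum_(x in W) expR (Z x))); last first.
    rewrite big_mkcond /=; apply: ler_sum => x _.
    by case: ifP => // _; apply: expR_ge0.
  apply: (@le_trans _ _ (\sum_(x in W) expR c * (1 - c + Z x))); last first.
    apply: ler_sum => x _; have := expR_ge1Dx (Z x - c).
    rewrite expRB ler_pdivlMr ?expR_gt0 // mulrC; apply: le_trans.
    by rewrite ler_pM2l ?expR_gt0 //; lra.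
  rewrite -big_distrr /= mulrC ler_pM2l ?expR_gt0 // big_split /= sumr_const.
  suff : #|W|%:R * c <= \sum_(x in W) Z x by rewrite -mulr_natl; lra.
  rewrite exchange_big /= /c mulrCA -[m in m%:R](card_ord m) mulr_natl -sumr_const.
  apply: ler_sum => b _; rewrite -big_distrr /= mulrCA ler_pM2l //.
  rewrite sumrB sumr_const -[p *+ _]mulr_natl mulrBr lerD2l lerN2.
  have bI : injective [ffun j => f (b, j)].
    by move=> i j; rewrite !ffunE => /fI/pair_equal_spec [].
  have := avg _ bI; rewrite mulrC; apply: le_trans.
  rewrite -sum1dep_card natr_sum big_mkcondr /=.
  apply: ler_sum => x _; rewrite /ind.
  have -> : [ffun j => x ([ffun j => f (b, j)] j)] = [ffun j => x (f (b, j))].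
    by apply/ffunP => j; rewrite !ffunE.
  by case: (_ \in F).
have := le_trans lower upper; rewrite -ler_pdivlMr ?expR_gt0 // -[in X in X -> _]mulrA -expRB.
suff -> : m%:R * (2 * t ^+ 2) - c = - (m%:R * (p - a) ^+ 2 / 8) by [].
by rewrite /c /t; field.
Qed.

Lemma link_count_perm (I T : finType) e (E : {set {set T}}) (D : {set T})
    (s : {perm I}) (x : {ffun I -> T}) :
  (link_count e E D [ffun i => x (s i)] <= link_count e E D x)%N.
Proof.
rewrite /link_count.
rewrite -(card_imset (f := fun h : {ffun 'I_e -> I} => [ffun j => s (h j)])); last first.
  by move=> g h /ffunP gh; apply/ffunP => j; have := gh j; rewrite !ffunE => /perm_inj.
apply/subset_leq_card/fintype.subsetP => _ /imsetP [h + ->].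
rewrite !inE => /andP [/injectiveP hI].
have -> : [ffun j => [ffun i => x (s i)] (h j)] = [ffun j => x ([ffun j => s (h j)] j)].
  by apply/ffunP => j; rewrite !ffunE.
move=> ->; rewrite andbT; apply/injectiveP => i j; rewrite !ffunE => /perm_inj.
exact: hI.
Qed.

Lemma disjoint_blocks m e r : (m * e <= r)%N -> exists f : 'I_m * 'I_e -> 'I_r, injective f.
Proof.
move=> mer; have cA : #|{: 'I_m * 'I_e}| = (m * e)%N by rewrite card_prod !card_ord.
exists (fun c => widen_ord mer (cast_ord cA (enum_rank c))) => c c' /(congr1 val) /= H.
by apply: enum_rank_inj; apply: val_inj.
Qed.

(** Degrees have density [a + eps] while failing tuples have link density at most [a]; the gap [eps]
    enters the deviation bound with [r %/ e] disjoint blocks of size [e]. *)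
Lemma matchable_of_min_degree (R : realType) (V : finType) d k r N
    (E : {set {set V}}) (a eps : R) :
  let e := (k - d)%N in
  (0 < r)%N -> (d <= r)%N -> kgraph k E ->
  #|V| = (N * r)%N -> (0 < N)%N -> (2 * r ^ 2 <= N)%N ->
  0 <= a -> 0 < eps ->
  (e`! * pm_threshold d k r + e * d.+1 * r ^ e.-1)%:R <= a * (r ^_ e)%:R ->
  (2 * r * 'C(r, d))%:R < expR ((r %/ e)%:R * eps ^+ 2 / 8) ->
  (forall D : {set V}, #|D| = d -> (a + eps) * (#|V| ^ e)%:R <= (e`! * degree E D)%:R) ->
  matchable E [set: V]%SET.
Proof.
case: r => // r' e _ dr kE cV N0 rN a0 eps0 ra rexp degE.
(* The deviation bound for tuples of low link count; its integer part serves as [w]. *)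
pose y : R := (#|V| ^ r'.+1)%:R * expR (- ((r'.+1 %/ e)%:R * eps ^+ 2 / 8)).
have y0 : 0 <= y by rewrite mulr_ge0 // expR_ge0.
have V0 : (0 < #|V|)%N by rewrite cV muln_gt0 N0.
apply: (perfect_matching_of_concentration (w := Num.truncn y) dr kE cV N0 rN) => [D cD|].
  rewrite -ltnS -(ltr_nat R); apply: le_lt_trans (truncnS_gt y).
  have [f fI] := disjoint_blocks (leq_divM r'.+1 e).
  have := @symmetric_set_small R 'I_r'.+1 V _ _ f (link_tuples e E D) _ (a + eps) a V0 fI a0.
  rewrite /y card_ord addrAC subrr add0r; apply.
  - by rewrite ltrDl.
  - by have := card_link_tuples D kE; rewrite cD => ->; apply: degE.
  - move=> s x; rewrite !inE; apply: leq_trans; exact: link_count_perm.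
  - move=> x; rewrite inE => xA; apply: le_trans ra; rewrite ler_nat; exact: xA.
rewrite -(ltr_nat R) natrM; apply: (@le_lt_trans _ _ ((2 * r'.+1 * 'C(r'.+1, d))%:R * y)).
  by rewrite ler_wpM2l // truncn_le.
rewrite /y mulrCA gtr_pMr ?ltr0n ?expn_gt0 ?V0 //.
by rewrite expRN ltr_pdivrMr ?expR_gt0 // mul1r.
Qed.

(** * Normalised thresholds and growth estimates *)

Definition threshold_density (R : realType) (d k n : nat) : R :=
  (pm_threshold d k n * (k - d)`!)%:R / (n ^ (k - d))%:R.

Lemma threshold_density_ge0 (R : realType) d k n : 0 <= threshold_density R d k n.
Proof. by rewrite divr_ge0. Qed.

Lemma threshold_density_le1 (R : realType) d k n :
  (d <= k)%N -> (0 < n)%N -> (k %| n)%N -> threshold_density R d k n <= 1.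
Proof.
move=> dk n0 kn; rewrite ler_pdivrMr ?ltr0n ?expn_gt0 ?n0 // mul1r ler_nat.
apply: leq_trans (pm_threshold_le_exp dk n0 kn) _.
apply: leq_trans (ffact_le_exp _ _) _.
by case: (k - d)%N => // i; rewrite leq_exp2r ?leq_subr.
Qed.

Lemma threshold_densityE (R : realType) d k n : (0 < n)%N ->
  (pm_threshold d k n * (k - d)`!)%:R = threshold_density R d k n * (n ^ (k - d))%:R.
Proof. by move=> n0; rewrite mulfVK // pnatr_eq0 -lt0n expn_gt0 n0. Qed.

Lemma eventually_ge (R : realType) (x : R) : exists N, forall n, (N <= n)%N -> x <= n%:R.
Proof.
exists (Num.truncn x).+1 => n Nn.
by apply: le_trans (ltW (truncnS_gt x)) _; rewrite ler_nat.
Qed.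

(** The term of degree [d.+2] of the exponential series outgrows [2 * r ^ d.+1]. *)
Lemma eventually_poly_lt_exp (R : realType) (d e : nat) (eps : R) :
  (0 < e)%N -> 0 < eps ->
  exists r0, forall r, (r0 <= r)%N ->
    (2 * r * 'C(r, d))%:R < expR ((r %/ e)%:R * eps ^+ 2 / 8).
Proof.
move=> e0 eps0; pose c : R := eps ^+ 2 / (16 * e%:R).
have e0' : 0 < e%:R :> R by rewrite ltr0n.
have c0 : 0 < c by rewrite divr_gt0 ?exprn_gt0 // mulr_gt0.
have [N Nle] := eventually_ge (2 * (d.+2)`!%:R / c ^+ d.+2).
exists (maxn N (2 * e)) => r; rewrite geq_max => /andP [/Nle rN re].
have r0 : (0 < r)%N by lia.
have le_c : c * r%:R <= (r %/ e)%:R * eps ^+ 2 / 8.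
  have : (r <= 2 * e * (r %/ e))%N.
    by have := ltn_ceil r e0; have : (2 * e <= r)%N := re; nia.
  rewrite -(ler_nat R) !natrM => le_r.
  have -> : (r %/ e)%:R * eps ^+ 2 / 8 = c * (2%:R * e%:R * (r %/ e)%:R).
    by rewrite /c; field; rewrite gt_eqF.
  by rewrite ler_pM2l.
apply: (@le_lt_trans _ _ (2 * r%:R ^+ d.+1)).
  by rewrite -natrX -natrM ler_nat -mulnA leq_mul2l /= expnS leq_mul2l bin_le_exp orbT.
have cr0 : 0 <= c * r%:R by rewrite mulr_ge0 // ltW.
apply: lt_le_trans (_ : 1 + (c * r%:R) ^+ d.+2 / d.+2`!%:R <= _); last first.
  apply: le_trans (expR_ge1Dxn d.+1 cr0) _.
  by rewrite ler_expR.
apply: (@le_lt_trans _ _ ((c * r%:R) ^+ d.+2 / d.+2`!%:R)); last by rewrite ltrDr.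
rewrite ler_pdivlMr ?ltr0n ?fact_gt0 // exprMn [r%:R ^+ d.+2]exprS.
rewrite mulrAC mulrA ler_pM2r ?exprn_gt0 ?ltr0n //.
by move: rN; rewrite ler_pdivrMr ?exprn_gt0 // (mulrC r%:R).
Qed.

(** * Convergence *)

(** The additive factorial of [e] pays for rounding the degree condition up to an integer. *)
Lemma pm_threshold_multiple (R : realType) d k r N (a eps : R) :
  let e := (k - d)%N in
  (0 < r)%N -> (d <= r)%N -> (0 < N)%N -> (2 * r ^ 2 <= N)%N ->
  0 <= a -> 0 < eps ->
  (e`! * pm_threshold d k r + e * d.+1 * r ^ e.-1)%:R <= a * (r ^_ e)%:R ->
  (2 * r * 'C(r, d))%:R < expR ((r %/ e)%:R * eps ^+ 2 / 8) ->
  (pm_threshold d k (N * r) * e`!)%:R <= (a + eps) * ((N * r) ^ e)%:R + e`!%:R.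
Proof.
move=> e r0 dr N0 rN a0 eps0 ra rexp.
pose y : R := (a + eps) * ((N * r) ^ e)%:R / e`!%:R.
have e0 : 0 < e`!%:R :> R by rewrite ltr0n fact_gt0.
have y0 : 0 <= y by rewrite divr_ge0 // mulr_ge0 // addr_ge0 // ltW.
have : (pm_threshold d k (N * r) <= (Num.truncn y).+1)%N.
  apply: pm_threshold_min; apply/forallP => E; apply/implyP => kE; apply/implyP => mE.
  apply: (@matchable_of_min_degree R _ d k r N E a eps) => //; first by rewrite card_ord.
  move=> D cD; have := leq_trans mE (min_degree_le_degree E cD).
  rewrite -(ler_nat R) card_ord natrM => /(lt_le_trans (truncnS_gt y)) /ltW.
  by rewrite /y ler_pdivrMr // (mulrC (_`!)%:R).
rewrite -(ler_nat R) natrM -(ler_pM2r e0) => le1; apply: le_trans le1 _.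
rewrite -natr1 mulrDl mul1r lerD2r.
by rewrite -ler_pdivlMr // truncn_le.
Qed.

(** One [eps] absorbs the lower-order terms in [r], one is the deviation in the sampling, and one
    pays for rounding and for the edges removed when [r] does not divide [n]. *)
Lemma threshold_density_almost_nonincreasing (R : realType) (d k : nat) (eps : R) :
  (d < k)%N -> 0 < eps -> eps <= 1 ->
  exists r0, forall r, (r0 <= r)%N -> (0 < r)%N -> (k %| r)%N ->
    exists n0, forall n, (n0 <= n)%N -> (k %| n)%N ->
      threshold_density R d k n <= threshold_density R d k r + 3 * eps.
Proof.
move=> dk eps0 eps1; set e := (k - d)%N.
have e0 : (0 < e)%N by rewrite subn_gt0.
have [r1 r1P] := eventually_poly_lt_exp d e0 eps0.
(* Twice [e ^ 2] for the falling factorial, weighted by [b <= 1] and by [eps <= 1], and [e * d.+1]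
   for the resampled coordinates. *)
have [r2 r2P] := eventually_ge ((2 * e ^ 2 + e * d.+1)%:R / eps).
exists (maxn r1 r2) => r; rewrite geq_max => /andP [/r1P rexp /r2P rpoly] r0 kr.
have dr : (d <= r)%N by apply: leq_trans (ltnW dk) (dvdn_leq r0 kr).
set b := threshold_density R d k r.
have b0 : 0 <= b by apply: threshold_density_ge0.
have b1 : b <= 1 by apply: threshold_density_le1 => //; apply: ltnW.
have eE : e = e.-1.+1 by rewrite prednK.
have ra : (e`! * pm_threshold d k r + e * d.+1 * r ^ e.-1)%:R <= (b + eps) * (r ^_ e)%:R.
  rewrite natrD mulnC threshold_densityE // -/b -/e.
  have := exp_le_ffact 0 r e; rewrite subn0 addn0 -(ler_nat R) natrD => le_ff.
  have rE : (r ^ e)%:R = r%:R * (r ^ e.-1)%:R :> R by rewrite {1}eE expnS natrM.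
  move: rpoly; rewrite ler_pdivrMr //.
  have : 0 <= (r ^ e.-1)%:R :> R by [].
  move: le_ff; rewrite rE -mulnn !natrM natrD !natrM.
  set X := (r ^ e.-1)%:R; set Y := (r ^_ e)%:R; set e' : R := e%:R; set d' : R := d.+1%:R.
  set r' : R := r%:R => le_ff X0 rpoly.
  have e'0 : 0 <= e' by [].
  have h1 : b * (r' * X) <= b * (Y + e' * e' * X) by rewrite ler_wpM2l.
  have h2 : b * (e' * e' * X) <= e' * e' * X by rewrite ler_piMl // !mulr_ge0.
  have h3 : eps * (r' * X) <= eps * (Y + e' * e' * X) by rewrite ler_wpM2l // ltW.
  have h4 : eps * (e' * e' * X) <= e' * e' * X by rewrite ler_piMl // !mulr_ge0.
  have h5 : (2 * (e' * e') + e' * d') * X <= r' * eps * X by rewrite ler_wpM2r.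
  lra.
(* The 1 accounts for rounding, and [r] for the fewer than [r] deleted vertices. *)
have [n1 n1P] := eventually_ge ((e`! * (1 + r))%:R / eps).
exists (maxn n1 (r * (2 * r ^ 2).+1)) => n; rewrite geq_max => /andP [/n1P nlarge nr] kn.
pose N := (n %/ r)%N.
have NrN : (2 * r ^ 2 < N)%N by rewrite /N leq_divRL // mulnC.
have n0 : (0 < n)%N by apply: leq_trans nr; rewrite muln_gt0 r0.
have N0 : (0 < N)%N by apply: leq_ltn_trans NrN.
have := pm_threshold_multiple r0 dr N0 (ltnW NrN) (addr_ge0 b0 (ltW eps0)) eps0 ra rexp.
rewrite -/e => leNr.
(* Both [n] and [r] are divisible by [k], so the remaining vertices can be used up by [j] whole
   edges. *)
have [j jE] : exists j, (n %% r = j * k)%N.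
  by apply/dvdnP; rewrite /dvdn modn_dvdm.
have nE : (n = N * r + j * k)%N by rewrite -jE; apply: divn_eq.
have dNr : (d <= N * r)%N by apply: leq_trans dr _; rewrite leq_pmull.
have := pm_threshold_steps j dk dNr; rewrite -nE subnS -/e -(leq_pmul2r (fact_gt0 e)) mulnDl.
rewrite -(ler_nat R) natrD => lestep.
have X1 : 1 <= (n ^ e.-1)%:R :> R by rewrite ler1n expn_gt0 n0.
have nX : (n ^ e)%:R = n%:R * (n ^ e.-1)%:R :> R by rewrite {1}eE expnS natrM.
have le_pow : ((N * r) ^ e)%:R <= (n ^ e)%:R :> R.
  by rewrite ler_nat leq_exp2r // nE leq_addr.
have le_jk : (j * k * n ^ e.-1 * e`!)%:R <= (r * n ^ e.-1 * e`!)%:R :> R.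
  by rewrite ler_nat !leq_mul2r -jE (ltnW (ltn_pmod n r0)) !orbT.
rewrite /threshold_density -/b -/e ler_pdivrMr; last by rewrite ltr0n expn_gt0 n0.
apply: le_trans lestep _.
have h1 : (b + eps + eps) * ((N * r) ^ e)%:R <= (b + eps + eps) * (n ^ e)%:R.
  by rewrite ler_wpM2l // !addr_ge0 // ltW.
have h2 : e`!%:R <= e`!%:R * (n ^ e.-1)%:R :> R by rewrite ler_peMr.
have h3 : (e`! * (1 + r))%:R * (n ^ e.-1)%:R <= eps * (n ^ e)%:R.
  rewrite nX mulrA ler_wpM2r //; move: nlarge; rewrite ler_pdivrMr //.
  by rewrite mulrC.
move: leNr le_jk h1 h2 h3; rewrite !natrM natrD; set A := (_ ^ _)%:R; lra.
Qed.

(* The limit is the limit superior of [b]. *)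
Lemma cvg_of_almost_nonincreasing (R : realType) (P : nat -> Prop) (b : nat -> R) :
  (forall n, exists2 m, (n <= m)%N & P m) ->
  (forall n, P n -> 0 <= b n <= 1) ->
  (forall eps, 0 < eps -> exists r0, forall r, (r0 <= r)%N -> P r ->
    exists n0, forall n, (n0 <= n)%N -> P n -> b n <= b r + eps) ->
  exists mu, 0 <= mu <= 1 /\ forall eps, 0 < eps ->
    exists n0, forall n, (n0 <= n)%N -> P n -> `|mu - b n| <= eps.
Proof.
move=> Pinf b01 bmono.
pose S := [set y | exists n0, forall n, (n0 <= n)%N -> P n -> b n <= y]%classic.
have S1 : S 1 by exists 0%N => n _ /b01 /andP [].
have Slb : lbound S 0.
  move=> y [n0 n0P]; have [m n0m Pm] := Pinf n0.
  by apply: le_trans (n0P m n0m Pm); have /andP [] := b01 m Pm.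
have Sinf : has_inf S by split; [exists 1 | exists 0].
exists (inf S); split.
  by rewrite lb_le_inf //=; [apply: ge_inf => //; case: Sinf | exists 1].
move=> eps eps0; have [y [n1 n1P] yS] := inf_adherent eps0 Sinf.
have [r0 r0P] := bmono _ eps0.
exists (maxn n1 r0) => n; rewrite geq_max => /andP [n1n r0n] Pn.
(* For late [n], [b n] is at most [y < inf S + eps], while almost monotonicity puts [b n + eps] into
   [S]. *)
have le1 : b n <= y := n1P n n1n Pn.
have le2 : inf S <= b n + eps by apply: ge_inf; [case: Sinf | apply: r0P].
by rewrite ler_norml; lra.
Qed.

(** Compares the two normalisations: the falling factorial is at most the power and misses it by at
    most [e * k * n ^ e.-1], weighted by [a <= 1]. *)
Lemma threshold_ratio_bounds (R : realType) (d k n : nat) :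
  (d < k)%N -> (0 < n)%N -> (k %| n)%N ->
  let e := (k - d)%N in
  let a : R := (pm_threshold d k n)%:R / ('C(n - d, e))%:R in
  threshold_density R d k n <= a /\
  a * n%:R <= threshold_density R d k n * n%:R + (e * k)%:R.
Proof.
move=> dk n0 kn e a.
have kn' : (k <= n)%N := dvdn_leq n0 kn.
have C0 : 0 < ('C(n - d, e))%:R :> R by rewrite ltr0n bin_gt0 leq_sub2r.
have f0 : 0 < e`!%:R :> R by rewrite ltr0n fact_gt0.
have e0 : (0 < e)%N by rewrite subn_gt0.
have eE : e = e.-1.+1 by rewrite prednK.
have ed : (e + d)%N = k by rewrite /e subnK // ltnW.
pose t : R := (pm_threshold d k n * e`!)%:R.
have aE : t = a * ((n - d) ^_ e)%:R.
  by rewrite -bin_ffact /t /a !natrM mulrA divfK // gt_eqF.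
have bE : t = threshold_density R d k n * (n ^ e)%:R by apply: threshold_densityE.
have a0 : 0 <= a by rewrite divr_ge0.
have a1 : a <= 1.
  rewrite ler_pdivrMr // mul1r ler_nat; apply: pm_threshold_min.
  by apply: forces_pm_bin; rewrite // ltnW.
have Xe : 0 < (n ^ e)%:R :> R by rewrite ltr0n expn_gt0 n0.
have X0 : 0 < (n ^ e.-1)%:R :> R by rewrite ltr0n expn_gt0 n0.
have nX : (n ^ e)%:R = n%:R * (n ^ e.-1)%:R :> R by rewrite {1}eE expnS natrM.
have ff_le : ((n - d) ^_ e)%:R <= (n ^ e)%:R :> R.
  rewrite ler_nat; apply: leq_trans (ffact_le_exp _ _) _.
  by rewrite leq_exp2r // leq_subr.
split.
  by rewrite ler_pdivrMr // -/e -/t aE ler_wpM2l.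
have := exp_le_ffact d n e; rewrite ed -(ler_nat R) natrD natrM => le_ff.
rewrite -(ler_pM2r X0) mulrDl -(mulrA a) -(mulrA (threshold_density R d k n)) -nX -bE aE.
apply: le_trans (ler_wpM2l a0 le_ff) _; rewrite mulrDr lerD2l.
by rewrite ler_piMl // mulr_ge0.
Qed.

Unset Implicit Arguments.
Local Open Scope classical_set_scope.

Theorem theorem1p2 (R : realType) (d k : nat) (hd : (0 < d)%N) (hdk : (d < k)%N) :
  exists mu : R, 0 <= mu <= 1 /\
    (pm_threshold d k n)%:R / ('C(n - d, k - d))%:R
      @[n --> within [set n : nat | (0 < n)%N /\ (k %| n)%N] \oo] --> mu.
Proof.
have k0 : (0 < k)%N by apply: leq_trans hdk.
have [] := @cvg_of_almost_nonincreasing R (fun n => (0 < n)%N /\ (k %| n)%N)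
  (threshold_density R d k).
- move=> n; exists (n.+1 * k)%N; last by rewrite muln_gt0 k0 dvdn_mull.
  by rewrite mulSn; nia.
- by move=> n [n0 kn]; rewrite threshold_density_ge0 threshold_density_le1 // ltnW.
- move=> eps eps0; pose eps' := Num.min (eps / 3) 1.
  have eps'0 : 0 < eps' by rewrite lt_min divr_gt0 //= ltr01.
  have eps'1 : eps' <= 1 by rewrite ge_min lexx orbT.
  have eps'3 : 3 * eps' <= eps.
    by have : eps' <= eps / 3 by [rewrite ge_min lexx]; lra.
  have [r0 r0P] := threshold_density_almost_nonincreasing hdk eps'0 eps'1.
  exists r0 => r r0r [rpos kr]; have [n0 n0P] := r0P r r0r rpos kr.
  exists n0 => n n0n [_ kn]; apply: le_trans (n0P n n0n kn) _.
  by rewrite lerD2l.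
move=> mu [mu01 muP]; exists mu; split=> //.
apply/cvgrPdist_le => eps eps0.
(* Half of [eps] goes to the convergence of the density, half to the change of normalisation. *)
have [n1 n1P] := muP _ (divr_gt0 eps0 (ltr0n R 2)).
have [n2 n2P] := eventually_ge (((k - d) * k)%:R / (eps / 2)).
exists (maxn n1 n2) => // n /=; rewrite geq_max => /andP [n1n n2n] [n0 kn].
have [lo] := threshold_ratio_bounds R hdk n0 kn.
have := n1P n n1n (conj n0 kn); rewrite !ler_norml => /andP [b1 b2].
have := n2P n n2n; rewrite ler_pdivrMr ?divr_gt0 // => small hi.
have n0R : 0 < n%:R :> R by rewrite ltr0n.
have : threshold_density R d k n + eps / 2 >=
    (pm_threshold d k n)%:R / ('C(n - d, k - d))%:R.
  rewrite -(ler_pM2r n0R) mulrDl; apply: le_trans hi _; rewrite lerD2l.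
  by rewrite mulrC.
by move: lo b1 b2; set a := _ / _; lra.
Qed.
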